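(* Let $R$ be a semiprimitive commutative ring with identity. The following statements are equivalent. (a) $h_M(x)$ is open in $\mathrm{Max}(R)$ for each $x\in R$. (b) Every ideal of $R$ is a $z$-ideal. (c) Every ideal of $R$ is a strong $z$-ideal. (d) Every ideal of $R$ is Hilbert. (e) Every finitely generated ideal of $R$ is a $z$-ideal. (f) Every finitely generated ideal of $R$ is a strong $z$-ideal. (g) Every principal ideal of $R$ is a $z$-ideal. (h) Every principal ideal of $R$ is a strong $z$-ideal. (i) Every essential ideal of $R$ is a $z$-ideal. (j) Every essential ideal of $R$ is a strong $z$-ideal. (k) Every ideal of $R$ is semiprime. (l) $R$ is a von Neumann regular ring. (m) Every prime ideal of $R$ is maximal.
   Context: $\mathrm{Max}(R)$ is the set of maximal ideals of $R$; for $S\subseteq R$, $h_M(S)=\{M\in\mathrm{Max}(R): S\subseteq M\}$, and $h_M(x)=h_M(\{x\})$. $\mathrm{Max}(R)$ carries the Zariski topology, whose closed sets are the sets $h_M(S)$. $R$ is semiprimitive if the intersection of all its maximal ideals is $\{0\}$. For a family $\mathcal{A}$ of ideals, $k(\mathcal{A})$ is its intersection (with $k(\emptyset)=R$). An ideal $I$ is a $z$-ideal if $k(h_M(x))\subseteq I$ for every $x\in I$, and a strong $z$-ideal if $k(h_M(F))\subseteq I$ for every finite subset $F\subseteq I$. An ideal is Hilbert if it is an intersection of maximal ideals, and semiprime if it is an intersection of prime ideals (the empty intersection being $R$). An ideal is essential if it meets every nonzero ideal of $R$ nontrivially. $R$ is von Neumann regular if for every $x\in R$ there is $y\in R$ with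 $x=x^2y$. *)

(* Defs.v *)
From HB Require Import structures.
From mathcomp Require Import all_boot all_order all_algebra.
From mathcomp Require Import boolp classical_sets cardinality.
From mathcomp Require Import topology.

Set Implicit Arguments.
Unset Strict Implicit.
Unset Printing Implicit Defensive.

Import GRing.Theory.

Local Open Scope classical_set_scope.
Local Open Scope ring_scope.

(* The zero ring is allowed ([comPzRingType]). The ideals of [ring_quotient]
   are boolean predicates, proper by definition, over nonzero rings only, hence
   the set-based notions below, for which the whole ring is an ideal. *)

Section Ideals.
Variable R : comPzRingType.
Implicit Types (I J : set R) (S : set R) (x : R).

Definition ideal I : Prop :=
  [/\ I 0, forall x y, I x -> I y -> I (x + y) & forall a x, I x -> I (a * x)].

Definition prime_ideal I : Prop :=
  [/\ ideal I, I <> setT & forall x y, I (x * y) -> I x \/ I y].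

Definition maximal_ideal I : Prop :=
  [/\ ideal I, I <> setT
    & forall J, ideal J -> I `<=` J -> J = I \/ J = setT].

Definition ideal_gen S : set R := smallest ideal S.

Definition fg_ideal I : Prop := exists2 F, finite_set F & I = ideal_gen F.

Definition principal_ideal I : Prop := exists x, I = ideal_gen [set x].

Definition essential_ideal I : Prop :=
  ideal I /\ forall J, ideal J -> J <> [set 0] -> I `&` J <> [set 0].

Definition semiprime_ideal I : Prop :=
  exists2 P : set (set R), P `<=` prime_ideal & I = \bigcap_(J in P) J.

End Ideals.

Record maxSpec (R : comPzRingType) := MaxSpec {
  max_ideal :> set R;
  max_idealP : maximal_ideal max_ideal
}.

Section MaximalSpectrum.
Variable R : comPzRingType.
Implicit Types (I S : set R) (A : set (maxSpec R)) (M : maxSpec R).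

Definition hM S : set (maxSpec R) := [set M | S `<=` M].

(* An intersection over the empty family is [setT]. *)
Definition kM A : set R := \bigcap_(M in A) (M : set R).

Definition z_ideal I : Prop :=
  ideal I /\ forall x, I x -> kM (hM [set x]) `<=` I.

Definition strong_z_ideal I : Prop :=
  ideal I /\ forall F, finite_set F -> F `<=` I -> kM (hM F) `<=` I.

Definition hilbert_ideal I : Prop := exists A, I = kM A.

Lemma max_ideal_ideal M : ideal M.
Proof. by case: (max_idealP M). Qed.

Lemma max_ideal_not1 M : ~ max_ideal M 1.
Proof.
have [[_ _ IM] MT _] := max_idealP M => M1.
by apply: MT; apply/seteqP; split=> // x _; rewrite -[x]mulr1; apply: IM.
Qed.

Lemma max_ideal_prime M : prime_ideal M.
Proof.
have [[M0 MD MM] MT Mmax] := max_idealP M.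
split=> // x y Mxy; have [Mx|nMx] := pselect (max_ideal M x); first by left.
right; pose J : set R := [set z | exists a m, max_ideal M m /\ z = a * x + m].
have idJ : ideal J.
  split=> [|_ _ [a [m [Mm ->]]] [b [n [Mn ->]]]|c _ [a [m [Mm ->]]]].
  - by exists 0, 0; rewrite mul0r addr0.
  - by exists (a + b), (m + n); split; [exact: MD|rewrite mulrDl addrACA].
  - by exists (c * a), (c * m); split; [exact: MM|rewrite mulrDr mulrA].
have MJ : M `<=` J by move=> m Mm; exists 0, m; rewrite mul0r add0r.
have [JM|JT] := Mmax J idJ MJ.
  by case: nMx; rewrite -JM; exists 1, 0; rewrite mul1r addr0.
have [a [m [Mm e]]] : J 1 by rewrite JT.
rewrite -[y]mul1r e mulrDl; apply: (MD); first by rewrite -mulrA; exact: MM.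
by rewrite mulrC; exact: MM.
Qed.

Definition zariski_open (U : set (maxSpec R)) : Prop :=
  exists S, ~` U = hM S.

Lemma zariski_openT : zariski_open setT.
Proof.
exists setT; rewrite setCT; apply/seteqP; split=> // M MT.
exact: (max_ideal_not1 (MT 1 I)).
Qed.

Lemma zariski_openI : setI_closed zariski_open.
Proof.
move=> U V [S US] [T VT].
exists [set z | exists s t, [/\ S s, T t & z = s * t]].
rewrite setCI US VT; apply/seteqP; split=> M.
  have [_ _ MM] := max_ideal_ideal M.
  case=> [SM|TM] _ [s [t [Ss Tt ->]]].
    by rewrite mulrC; apply/MM/SM.
  exact/MM/TM.
move=> STM; have [SM|/existsNP[s /not_implyP[Ss nMs]]] :=
  pselect (S `<=` M); [by left|right].
move=> t Tt; have [_ _ /(_ s t)] := max_ideal_prime M.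
by case=> //; apply: STM; exists s, t.
Qed.

Lemma zariski_open_bigU (I : Type) (f : I -> set (maxSpec R)) :
  (forall i, zariski_open (f i)) -> zariski_open (\bigcup_i f i).
Proof.
move=> /choice[S fS]; exists (\bigcup_i S i); rewrite setC_bigcup.
apply/seteqP; split=> M.
  by move=> fM s [i _ Sis]; have := fM i Logic.I; rewrite fS; apply.
by move=> SM i _; rewrite fS => s Sis; apply: SM; exists i.
Qed.

End MaximalSpectrum.

HB.instance Definition _ (R : comPzRingType) := gen_eqMixin (maxSpec R).
HB.instance Definition _ (R : comPzRingType) := gen_choiceMixin (maxSpec R).
HB.instance Definition _ (R : comPzRingType) :=
  isOpenTopological.Build (maxSpec R)
    (@zariski_openT R) (@zariski_openI R) (@zariski_open_bigU R).

Lemma zariski_closedP (R : comPzRingType) (A : set (maxSpec R)) :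
  closed A <-> exists S, A = hM S.
Proof.
rewrite -openC.
have -> : open (~` A) = zariski_open (~` A) by [].
by rewrite /zariski_open setCK.
Qed.

Definition semiprimitive (R : comPzRingType) : Prop :=
  kM [set: maxSpec R] = [set 0].

Definition von_neumann_regular (R : comPzRingType) : Prop :=
  forall x : R, exists y, x = x ^+ 2 * y.

(* Main.v *)
Require Import Defs.
From HB Require Import structures.
From mathcomp Require Import all_boot all_order all_algebra.
From mathcomp Require Import boolp classical_sets cardinality.
From mathcomp Require Import topology.
From mathcomp Require Import ring.

Import GRing.Theory.

Local Open Scope classical_set_scope.
Local Open Scope ring_scope.

(** The conditions are tied together by von Neumann regularity.

    If [R] is regular and [x = x ^+ 2 * y], then [e = x * y] is an idempotent
    generating the same ideal as [x].  An ideal [I] without [x] does not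
    contain [e], so the colon ideal [(I : e)] is proper; it contains [I] and
    [1 - e], and a maximal ideal above it contains [I] but not [x].  Hence every
    ideal is Hilbert ([vnr_hilbert]), which yields all the conditions on
    z-ideals, strong z-ideals and semiprime ideals, since maximal ideals are
    prime.  As a prime ideal contains exactly one of [e] and [1 - e], the sets
    [hM x] are clopen ([vnr_open]) and prime ideals are maximal
    ([vnr_prime_maximal]).

    In the other direction each condition produces [x = a * x ^+ 2].
    z-ideals and semiprime ideals both contain [x] as soon as they contain
    [x ^+ 2], which settles the case of principal ideals (apply it to the ideal
    of [x ^+ 2]).  For essential ideals one adds to [x ^+ 2] its annihilator:
    the sum is essential, so it contains [x], and semiprimitivity kills the
    annihilator component ([essential_z_vnr]).  If [hM x] is open with complement
    [hM S], then [x] and [S] generate the unit ideal while [x * s] lies in every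
    maximal ideal for [s] in the ideal of [S] ([open_vnr]).  If primes are
    maximal, a prime avoiding all the products [x ^+ n * (1 - a * x)] would be a
    maximal ideal modulo which [x] is nonzero and not invertible; so one of
    these products is zero ([prime_maximal_vnr]). *)

Section IdealTheory.
Set Implicit Arguments.
Unset Strict Implicit.
Unset Printing Implicit Defensive.

Context {R : comPzRingType}.
Implicit Types (I J K S : set R) (x y : R) (M : maxSpec R).

(** * Ideals, generators and Zorn's lemma *)

Lemma ideal_genP S : ideal (ideal_gen S).
Proof.
split=> [J [[J0 _ _] _]|x y Sx Sy J SJ|a x Sx J SJ].
- exact: J0.
- by have [[_ JD _] _] := SJ; apply: JD; [exact: Sx|exact: Sy].
- have [[_ _ JM] _] := SJ; apply: JM; exact: Sx.
Qed.

Lemma ideal0 : ideal [set (0 : R)].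
Proof. by split=> [//|_ _ -> ->|a _ ->]; rewrite /= ?addr0 ?mulr0. Qed.

Lemma fg_idealP I : fg_ideal I -> ideal I.
Proof. by move=> [F _ ->]; exact: ideal_genP. Qed.

Lemma principal_fg_ideal I : principal_ideal I -> fg_ideal I.
Proof. by move=> [x ->]; exists [set x]. Qed.

Definition ideal_adjoin I x : set R :=
  [set z | exists a i, I i /\ z = a * x + i].

Lemma ideal_adjoinP I x : ideal I -> ideal (ideal_adjoin I x).
Proof.
move=> [I0 ID IM]; split=> [|_ _ [a [i [Ii ->]]] [b [j [Ij ->]]]|
                            c _ [a [i [Ii ->]]]].
- by exists 0, 0; split=> //; ring.
- by exists (a + b), (i + j); split; [exact: ID|ring].
- by exists (c * a), (c * i); split; [exact: IM|ring].
Qed.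

Lemma sub_ideal_adjoin I x : I `<=` ideal_adjoin I x.
Proof. by move=> i Ii; exists 0, i; split=> //; ring. Qed.

Lemma mem_ideal_adjoin I x : ideal I -> ideal_adjoin I x x.
Proof. by move=> [I0 _ _]; exists 1, 0; split=> //; ring. Qed.

Lemma mem_principal x y : ideal_gen [set x] y -> exists a, y = a * x.
Proof.
move=> /(_ (ideal_adjoin [set 0] x))[|a [_ [->]]].
  by split=> [|_ ->]; [apply: ideal_adjoinP|apply: mem_ideal_adjoin]; exact: ideal0.
by rewrite addr0; exists a.
Qed.

Lemma idealT1 I : ideal I -> I 1 -> I = setT.
Proof.
by move=> [_ _ IM] I1; apply/seteqP; split=> // x _; rewrite -(mulr1 x); exact: IM.
Qed.

(** The common source of maximal ideals ([S] reduced to [1]) and of prime ideals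
    avoiding a multiplicative set. *)
Lemma exists_maximal_avoiding I S : ideal I -> (forall s, S s -> ~ I s) ->
  exists J, [/\ ideal J, I `<=` J, forall s, S s -> ~ J s &
    forall K, ideal K -> J `<=` K -> (forall s, S s -> ~ K s) -> K = J].
Proof.
move=> idI IS.
(* Adding [I] to every set makes the empty chain harmless: its union stands
   for [I] itself. *)
pose P := [set A | ideal (I `|` A) /\ forall s, S s -> ~ (I `|` A) s].
have [F FP Ftot|A [[idA AS] Amax]] := @Zorn_bigcup R P.
- have inF X z : F X -> (I `|` X) z -> (I `|` \bigcup_(X in F) X) z.
    by move=> FX [?|?]; [left|right; exists X].
  have [I0 ID IM] := idI.
  have FD X x y : F X -> (I `|` X) x -> (I `|` X) y ->
      (I `|` \bigcup_(X in F) X) (x + y).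
    move=> FX Xx Xy; have [[_ XD _] _] := FP _ FX.
    exact: (inF X _ FX (XD _ _ Xx Xy)).
  split; first split.
  + by left.
  + move=> x y [Ix|[X FX Xx]] [Iy|[Y FY Yy]].
    * by left; exact: ID.
    * by apply: (FD Y _ _ FY); [left|right].
    * by apply: (FD X _ _ FX); [right|left].
    * have [XY|YX] := Ftot _ _ FX FY.
      - by apply: (FD Y _ _ FY); right=> //; exact: XY.
      - by apply: (FD X _ _ FX); right=> //; exact: YX.
  + move=> a x [Ix|[X FX Xx]]; first by left; exact: IM.
    have [[_ _ XM] _] := FP _ FX.
    by apply: (inF X _ FX); apply: XM; right.
  + move=> s Ss [|[X FX Xs]]; first exact: IS.
    by have [_ /(_ s Ss)] := FP _ FX; apply; right.
- exists (I `|` A); split=> // K idK AK KS.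
  have IK : I `|` K = K by apply: setUidr => x Ix; apply: AK; left.
  apply/seteqP; split=> //; apply: contrapT => KA.
  apply: (Amax K); last by split; rewrite IK.
  split=> [x Ax|KA']; first by apply: AK; right.
  by apply: KA => x /KA'; right.
Qed.

(** An ideal [P] maximal among those avoiding [S] is prime: if [x] and [y] are
    outside [P], then the ideals generated by [P] and [x], and by [P] and [y],
    both meet [S], and the product of the common elements is in [S] and is
    congruent to a multiple of [x * y] modulo [P]. *)
Lemma exists_prime_avoiding I S : ideal I -> S 1 ->
    (forall s t, S s -> S t -> S (s * t)) -> (forall s, S s -> ~ I s) ->
  exists P, [/\ prime_ideal P, I `<=` P & forall s, S s -> ~ P s].
Proof.
move=> idI S1 SM /(exists_maximal_avoiding idI)[P [idP IP PS Pmax]].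
exists P; split=> //; split=> // [PT|x y Pxy]; first by apply: (PS 1); rewrite ?PT.
have meet z : ~ P z -> exists2 s, S s & ideal_adjoin P z s.
  move=> nPz; apply: contrapT => nS; apply: nPz.
  rewrite -(Pmax (ideal_adjoin P z)); first exact: mem_ideal_adjoin.
  - exact: ideal_adjoinP.
  - exact: sub_ideal_adjoin.
  - by move=> s Ss Ps; apply: nS; exists s.
have [Px|nPx] := pselect (P x); [by left|right].
apply: contrapT => /meet[t St [b [j [Pj tE]]]].
have [s Ss [a [i [Pi sE]]]] := meet _ nPx.
apply: (PS _ (SM _ _ Ss St)); have [_ PD PM] := idP; rewrite sE tE.
have -> : (a * x + i) * (b * y + j) =
    (a * b) * (x * y) + ((b * y + j) * i + (a * x) * j) by ring.
by apply: (PD); [exact: PM|apply: PD; exact: PM].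
Qed.

Lemma sub_max_ideal I : ideal I -> ~ I 1 -> exists M, I `<=` M.
Proof.
move=> idI I1; have [|N [idN IN N1 Nmax]] := @exists_maximal_avoiding I [set 1] idI.
  by move=> _ ->.
suff maxN : maximal_ideal N by exists (MaxSpec maxN).
split=> // [NT|J idJ NJ]; first by apply: (N1 1); rewrite ?NT.
have [J1|nJ1] := pselect (J 1); first by right; exact: idealT1.
by left; apply: Nmax => // _ ->.
Qed.

(** An element of no maximal ideal of the quotient by [I] is invertible in it. *)
Lemma comaximal I x : ideal I -> (forall M, I `<=` M -> ~ max_ideal M x) ->
  exists a, I (1 - a * x).
Proof.
move=> idI IM; have [[a [i [Ii ->]]]|nI] := pselect (ideal_adjoin I x 1).
  by exists a; have -> : a * x + i - a * x = i by ring.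
have [M JM] := sub_max_ideal (ideal_adjoinP x idI) nI.
case: (IM M); last by apply/JM/mem_ideal_adjoin.
by apply: subset_trans JM; exact: sub_ideal_adjoin.
Qed.

Lemma maximal_inverse M x : ~ max_ideal M x -> exists a, max_ideal M (1 - a * x).
Proof.
move=> nMx; have [idM MT Mmax] := max_idealP M.
apply: comaximal => // N MN Nx; have idN := max_ideal_ideal N.
have [NM|NT] := Mmax _ idN MN; first by apply: nMx; rewrite -NM.
by apply: (@max_ideal_not1 _ N); rewrite NT.
Qed.

(** * z-ideals, strong z-ideals and Hilbert ideals *)

Lemma kM_hM S : S `<=` kM (hM S).
Proof. by move=> x Sx M; exact. Qed.

Lemma strong_z_z_ideal I : strong_z_ideal I -> z_ideal I.
Proof.
move=> [idI Iz]; split=> // x Ix; apply: Iz; first exact: finite_set1.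
by move=> _ ->.
Qed.

Lemma hilbert_strong_z_ideal I : ideal I -> hilbert_ideal I -> strong_z_ideal I.
Proof.
move=> idI [A IA]; split=> // F _ FI x Fx; rewrite IA => M AM; apply: Fx.
by move=> y /FI; rewrite IA; exact.
Qed.

Lemma hilbert_semiprime_ideal I : hilbert_ideal I -> semiprime_ideal I.
Proof.
move=> [A ->]; exists [set max_ideal M | M in A].
  by move=> _ [M _ <-]; exact: max_ideal_prime.
by rewrite bigcap_image.
Qed.

Lemma prime_sqr I x : prime_ideal I -> I (x ^+ 2) -> I x.
Proof. by move=> [_ _ Ip]; rewrite expr2 => /Ip[]. Qed.

(** Maximal ideals being prime, [x] and [x ^+ 2] lie in the same ones. *)
Lemma z_ideal_sqr I x : z_ideal I -> I (x ^+ 2) -> I x.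
Proof.
move=> [_ Iz] /Iz; apply=> M Mx; apply: prime_sqr; first exact: max_ideal_prime.
exact: Mx.
Qed.

Lemma semiprime_ideal_sqr I x : semiprime_ideal I -> I (x ^+ 2) -> I x.
Proof.
by move=> [P Pp ->] Px J PJ; apply: prime_sqr; [exact: Pp|exact: Px].
Qed.

(** * Consequences of regularity *)

Section Regular.
Hypothesis vnr : von_neumann_regular R.

(** If [x] is not in [I], neither is the idempotent [e = x * y].  The maximal
    ideal separating [x] from [I] is taken above the colon ideal [(I : e)]: as
    the latter contains [1 - e], a maximal ideal above it cannot contain [x]. *)
Lemma vnr_hilbert I : ideal I -> hilbert_ideal I.
Proof.
move=> idI; have [I0 ID IM] := idI; exists (hM I).
apply/seteqP; split=> [|x Ix]; first exact: kM_hM.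
apply: contrapT => nIx; have [y xE] := vnr x.
pose J := [set r | I (r * (x * y))].
have idJ : ideal J.
  split=> [|r s Jr Js|a r Jr]; rewrite /J /= ?mul0r //.
  - by rewrite mulrDl; exact: ID.
  - by rewrite -mulrA; exact: IM.
have [|M JM] := sub_max_ideal idJ.
  move=> J1; apply: nIx; suff -> : x = x * (1 * (x * y)) by exact: IM.
  by rewrite {1}xE; ring.
have IsubM : I `<=` M by move=> r Ir; apply: JM; rewrite /J /= mulrC; exact: IM.
have [_ MD MM] := max_ideal_ideal M.
apply: (@max_ideal_not1 _ M).
have -> : 1 = (1 - x * y) + y * x by ring.
apply: MD; last by apply: MM; exact: Ix.
apply: JM; rewrite /J /=.
have -> : (1 - x * y) * (x * y) = (x - x ^+ 2 * y) * y by ring.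
by rewrite -xE subrr mul0r.
Qed.

Lemma vnr_strong_z I : ideal I -> strong_z_ideal I.
Proof. by move=> idI; apply/hilbert_strong_z_ideal/vnr_hilbert. Qed.

Lemma vnr_open x : open (hM [set x]).
Proof.
have [y xE] := vnr x; exists [set 1 - x * y].
apply/seteqP; split=> M /=.
- move=> nMx _ ->; have [[M0 _ _] _ /(_ x (1 - x * y))] := max_ideal_prime M.
  have -> : x * (1 - x * y) = x - x ^+ 2 * y by ring.
  by rewrite -xE subrr => /(_ M0)[Mx|//]; case: nMx => _ ->.
- move=> /(_ _ erefl) My /(_ _ erefl) Mx; apply: (@max_ideal_not1 _ M).
  have [_ MD MM] := max_ideal_ideal M.
  have -> : 1 = (1 - x * y) + y * x by ring.
  by apply: MD => //; exact: MM.
Qed.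

Lemma vnr_prime_maximal I : prime_ideal I -> maximal_ideal I.
Proof.
move=> [idI IT Ip]; split=> // J idJ IJ.
have [JI|/existsNP[x /not_implyP[Jx nIx]]] := pselect (J `<=` I).
  by left; apply/seteqP.
right; apply: idealT1 => //; have [y xE] := vnr x.
have [_ JD JM] := idJ; have [I0 _ _] := idI.
have -> : 1 = (1 - x * y) + y * x by ring.
apply: JD; last exact: JM.
apply: IJ; have [|//|//] := Ip x (1 - x * y).
have -> : x * (1 - x * y) = x - x ^+ 2 * y by ring.
by rewrite -xE subrr.
Qed.

End Regular.

(** * Criteria for regularity *)

(** Regularity says precisely that [x] is in the ideal generated by [x ^+ 2]. *)
Lemma sqr_closed_vnr :
  (forall I x, principal_ideal I -> I (x ^+ 2) -> I x) -> von_neumann_regular R.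
Proof.
move=> Rsqr x.
have [|a xE] := @mem_principal (x ^+ 2) x; last by exists a; rewrite mulrC.
apply: (Rsqr (ideal_gen [set x ^+ 2])); first by exists (x ^+ 2).
exact: sub_gen_smallest.
Qed.

(** A nonzero [k] in an ideal [K] either is annihilated by [z], hence is itself
    in the sum, or yields the nonzero common element [k * z]. *)
Lemma adjoin_annihilator_essential z :
  essential_ideal (ideal_adjoin [set n | n * z = 0] z).
Proof.
have idA : ideal [set n | n * z = 0].
  split=> [|m n /= mz nz|a n /= nz]; rewrite /= ?mul0r //.
    by rewrite mulrDl mz nz addr0.
  by rewrite -mulrA nz mulr0.
split=> [|K [K0 KD KM] Kn0 AK0]; first exact: ideal_adjoinP.
apply: Kn0; apply/seteqP; split=> [k Kk|_ ->]; last exact: K0.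
rewrite -AK0; split=> //; have [_ _ AM] := ideal_adjoinP z idA.
apply: sub_ideal_adjoin; rewrite /=.
have : (ideal_adjoin [set n | n * z = 0] z `&` K) (k * z).
  split; last by rewrite mulrC; exact: KM.
  by apply: AM; exact: mem_ideal_adjoin.
by rewrite AK0.
Qed.

Section Semiprimitive.
Hypothesis semiprimR : semiprimitive R.

Lemma semiprimitive_eq0 x : (forall M, max_ideal M x) -> x = 0.
Proof.
move=> Mx; have : kM [set: maxSpec R] x by move=> M _; exact: Mx.
by rewrite semiprimR.
Qed.

(** Semiprimitive rings are reduced, in a form that also cancels the powers of
    [x]: a maximal ideal containing the product contains one of its factors. *)
Lemma semiprimitive_reduced x y n : x ^+ n * y = 0 -> x * y = 0.
Proof.
move=> xy0; apply: semiprimitive_eq0 => M.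
have [[M0 _ MM] _ Mp] := max_ideal_prime M.
have [Mx|nMx] := pselect (max_ideal M x); first by rewrite mulrC; exact: MM.
apply: MM; have : max_ideal M (x ^+ n * y) by rewrite xy0.
elim: n {xy0} => [|n IHn]; first by rewrite expr0 mul1r.
by rewrite exprS -mulrA => /Mp[].
Qed.

(** If [hM S] is the complement of [hM x], no maximal ideal contains both [x] and
    [S], so some [1 - a * x] is in the ideal of [S].  As every maximal ideal
    contains [x] or [S], it contains [x * (1 - a * x)]. *)
Lemma open_vnr : (forall x, open (hM [set x])) -> von_neumann_regular R.
Proof.
move=> opR x; have [S xS] := opR x.
have hMS M : hM S M -> ~ max_ideal M x.
  by rewrite -xS => + Mx; apply=> _ ->.
have [M SM|a Sa] := @comaximal (ideal_gen S) x (ideal_genP S).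
  by apply: hMS; apply: subset_trans SM; exact: sub_gen_smallest.
exists a; apply/eqP; rewrite -subr_eq0; apply/eqP.
have -> : x - x ^+ 2 * a = x * (1 - a * x) by ring.
apply: semiprimitive_eq0 => M; have [_ _ MM] := max_ideal_ideal M.
have [Mx|nMx] := pselect (max_ideal M x); first by rewrite mulrC; exact: MM.
apply: MM; apply: Sa; split; first exact: max_ideal_ideal.
have : (~` hM [set x]) M by move=> /(_ _ erefl).
by rewrite xS.
Qed.

(** The square [x ^+ 2], rather than [x], generates the essential ideal: being a
    z-ideal it then contains [x], which expresses [x] as a multiple of
    [x ^+ 2] up to an element [n] killed by [x ^+ 2]. *)
Lemma essential_z_vnr :
  (forall I, essential_ideal I -> z_ideal I) -> von_neumann_regular R.
Proof.
move=> ez x; pose I := ideal_adjoin [set n | n * x ^+ 2 = 0] (x ^+ 2).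
have [||a [n [/= nx0 xE]]] := @z_ideal_sqr I x.
- exact/ez/adjoin_annihilator_essential.
- by exists 1, 0; split; rewrite /= ?mul0r ?mul1r ?addr0.
exists a; apply/eqP; rewrite -subr_eq0; apply/eqP.
(* The annihilator component [n] is [x * (1 - a * x)]. *)
have nE : n = x * (1 - a * x).
  have -> : x * (1 - a * x) = x - a * x ^+ 2 by ring.
  by rewrite {1}xE; ring.
have -> : x - x ^+ 2 * a = x * (1 - a * x) by ring.
by apply: (@semiprimitive_reduced _ _ 3); rewrite -nx0 nE; ring.
Qed.

(** The set of all [x ^+ n * (1 - a * x)] is closed under products because
    [(1 - a * x) * (1 - b * x) = 1 - (a + b - a * b * x) * x].  If it does not
    contain [0], some prime avoids it; this prime contains neither [x] nor any
    [1 - a * x], hence is not maximal. *)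
Lemma prime_maximal_vnr :
  (forall I, prime_ideal I -> maximal_ideal I) -> von_neumann_regular R.
Proof.
move=> pm x.
pose S := [set s | exists n a, s = x ^+ n * (1 - a * x)].
have [[n [a /esym/semiprimitive_reduced xa0]]|nS0] := pselect (S 0).
  exists a; apply/eqP; rewrite -subr_eq0; apply/eqP.
  by rewrite -xa0; ring.
have [|||P [Pp _ PS]] := @exists_prime_avoiding [set 0] S ideal0.
- by exists 0%N, 0; rewrite expr0; ring.
- move=> _ _ [m [a ->]] [n [b ->]].
  by exists (m + n)%N, (a + b - a * b * x); rewrite exprD; ring.
- by move=> s Ss s0; apply: nS0; rewrite -s0.
have [|a Pa] := @maximal_inverse (MaxSpec (pm P Pp)) x.
  by apply: PS; exists 1%N, 0; ring.
by case: (PS (1 - a * x)) => //; exists 0%N, a; rewrite expr0 mul1r.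
Qed.

End Semiprimitive.

End IdealTheory.

(** * The equivalences *)

Theorem theorem4p19 (R : comPzRingType) (semiprimR : semiprimitive R) :
  [<->
    forall x : R, open (hM [set x]);
    forall I : set R, ideal I -> z_ideal I;
    forall I : set R, ideal I -> strong_z_ideal I;
    forall I : set R, ideal I -> hilbert_ideal I;
    forall I : set R, fg_ideal I -> z_ideal I;
    forall I : set R, fg_ideal I -> strong_z_ideal I;
    forall I : set R, principal_ideal I -> z_ideal I;
    forall I : set R, principal_ideal I -> strong_z_ideal I;
    forall I : set R, essential_ideal I -> z_ideal I;
    forall I : set R, essential_ideal I -> strong_z_ideal I;
    forall I : set R, ideal I -> semiprime_ideal I;
    von_neumann_regular R;
    forall I : set R, prime_ideal I -> maximal_ideal I].
Proof.
have principal_vnr : (forall I : set R, principal_ideal I -> z_ideal I) ->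
    von_neumann_regular R.
  move=> pz; apply: sqr_closed_vnr => I x /pz; exact: z_ideal_sqr.
have vnr_z (vnr : von_neumann_regular R) (I : set R) : ideal I -> z_ideal I.
  by move=> idI; apply/strong_z_z_ideal/vnr_strong_z.
have principalP (I : set R) (pI : principal_ideal I) : ideal I.
  exact/fg_idealP/principal_fg_ideal.
tfae.
- by move=> /(open_vnr semiprimR); exact: vnr_z.
- move=> z; apply: vnr_strong_z; apply: principal_vnr => I /principalP; exact: z.
- move=> sz; apply: vnr_hilbert; apply: principal_vnr => I /principalP.
  by move=> /sz; exact: strong_z_z_ideal.
- move=> hR I /fg_idealP idI.
  exact/strong_z_z_ideal/hilbert_strong_z_ideal/hR.
- move=> fz I /fg_idealP; apply: vnr_strong_z; apply: principal_vnr => J.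
  by move=> /principal_fg_ideal; exact: fz.
- by move=> fsz I /principal_fg_ideal/fsz; exact: strong_z_z_ideal.
- by move=> /principal_vnr vnr I /principalP; exact: vnr_strong_z.
- move=> psz I [idI _]; apply: vnr_z => //; apply: principal_vnr => J /psz.
  exact: strong_z_z_ideal.
- by move=> /(essential_z_vnr semiprimR) vnr I [idI _]; exact: vnr_strong_z.
- move=> esz I idI; apply/hilbert_semiprime_ideal/vnr_hilbert => //.
  by apply: essential_z_vnr => // J /esz; exact: strong_z_z_ideal.
- move=> sp; apply: sqr_closed_vnr => I x /principalP/sp.
  exact: semiprime_ideal_sqr.
- exact: vnr_prime_maximal.
- by move=> /(prime_maximal_vnr semiprimR); exact: vnr_open.
Qed.
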